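(* Let $H$ be a separable complex Hilbert space, $A\in\mathcal{B}(H)^+$, $T\in\mathcal{B}(H)$, and let $Q\in\mathcal{B}(H)$ be a nilpotent operator of order $r\ge 1$. Let $m,n$ be nonnegative integers. If $T$ and $Q$ are doubly commuting, then the following hold. (1) If $T$ is $(A;(m,n))$-isosymmetric, then $T+Q$ is $(A;(m+2r-2,\,n+2r-1))$-isosymmetric. (2) If $T$ is skew $(A;(m,n))$-isosymmetric, then $T+Q$ is skew $(A;(m+2r-2,\,n+2r-1))$-isosymmetric.
   Context: $\mathcal{B}(H)$ is the algebra of bounded linear operators on $H$ and $\mathcal{B}(H)^+$ the set of positive (semi-definite) operators. $T$ and $Q$ are doubly commuting if $TQ=QT$ and $TQ^*=Q^*T$. $Q$ is nilpotent of order $r$ if $Q^r=0$ and $Q^{r-1}\neq0$. For $A,T\in\mathcal{B}(H)$ and nonnegative integers $m,n$ put $$\mathcal{S}^n_A(T)=\sum_{k=0}^n(-1)^{n-k}\binom nk T^{*k}AT^{n-k},\qquad \zeta^n_A(T)=\sum_{k=0}^n\binom nk T^{*k}AT^{n-k},$$ $$\Omega_A^{m,n}(T)=\sum_{j=0}^m(-1)^{m-j}\binom mj T^{*j}\mathcal{S}^n_A(T)T^j,\qquad \Lambda_A^{m,n}(T)=\sum_{j=0}^m(-1)^{m-j}\binom mj T^{*j}\zeta^n_A(T)T^j.$$ $T$ is $(A;(m,n))$-isosymmetric if $\Omega_A^{m,n}(T)=0$, and skew $(A;(m,n))$-isosymmetric if $\Lambda_A^{m,n}(T)=0$. *)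

(* Defs.v *)
From HB Require Import structures.
From mathcomp Require Import all_boot all_order all_algebra.
From mathcomp Require Import complex.
From mathcomp Require Import ring lra.
From mathcomp Require Import boolp classical_sets functions cardinality reals.
From mathcomp Require Import topology normedtype.

Set Implicit Arguments.
Unset Strict Implicit.
Unset Printing Implicit Defensive.

Import Order.TTheory GRing.Theory Num.Theory.
Import numFieldNormedType.Exports.

Local Open Scope classical_set_scope.
Local Open Scope ring_scope.
Local Open Scope complex_scope.

(* The inner product is linear in its first argument and conjugate-linear in
   the second one. *)
HB.mixin Record NormedModule_isHilbert (R : realType) H
    & CompleteNormedModule R[i] H := {
  inner : {dot H for (@Num.conj R[i])} ;
  sqr_norm_inner : forall x : H, `|x| ^+ 2 = inner x x }.

#[short(type="hilbertType")]
HB.structure Definition Hilbert (R : realType) :=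
  {H of CompleteNormedModule R[i] H & NormedModule_isHilbert R H}.

Notation "''[' x , y ]" := (inner x y) (format "''[' x ,  y ]") : ring_scope.

Definition separable_space (T : topologicalType) : Prop :=
  exists D : set T, countable D /\ dense D.

Section InnerTheory.
Variables (R : realType) (H : hilbertType R).
Implicit Types (x y z : H) (c : R[i]).

Lemma innerC x y : '[x, y] = ('[y, x])^*%R.
Proof. by rewrite hermC /= expr0 mul1r. Qed.
Lemma innerDl x y z : '[x + y, z] = '[x, z] + '[y, z].
Proof. exact: linearDl. Qed.
Lemma innerDr x y z : '[z, x + y] = '[z, x] + '[z, y].
Proof. exact: linearDr. Qed.
Lemma innerZl c x y : '[c *: x, y] = c * '[x, y].
Proof. exact: linearZl_LR. Qed.
Lemma innerZr c x y : '[x, c *: y] = (c^*)%R * '[x, y].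
Proof. exact: linearZr_LR. Qed.
Lemma innerNl x y : '[- x, y] = - '[x, y]. Proof. exact: linearNl. Qed.
Lemma innerNr x y : '[x, - y] = - '[x, y]. Proof. exact: linearNr. Qed.
Lemma innerBl x y z : '[x - y, z] = '[x, z] - '[y, z].
Proof. by rewrite innerDl innerNl. Qed.
Lemma innerBr x y z : '[z, x - y] = '[z, x] - '[z, y].
Proof. by rewrite innerDr innerNr. Qed.

Lemma inner_ge0 x : 0 <= '[x, x].
Proof. by rewrite -sqr_norm_inner exprn_ge0. Qed.

Lemma inner_injr y z : (forall x, '[x, y] = '[x, z]) -> y = z.
Proof.
move=> yz; apply/eqP; rewrite -subr_eq0 -normr_eq0 -sqrf_eq0 sqr_norm_inner.
by rewrite innerBr yz subrr.
Qed.

Lemma CauchySchwarz_inner x y : `|'[x, y]| <= `|x| * `|y|.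
Proof.
rewrite -ler_sqr ?nnegrE ?mulr_ge0// exprMn.
have [->|y0] := eqVneq y 0; first by rewrite linear0r !normr0 !expr0n mulr0.
have Y0 : 0 < `|y| ^+ 2 by rewrite exprn_gt0// normr_gt0.
pose a := '[x, y] / `|y| ^+ 2.
have aE : (a^*)%R = '[y, x] / `|y| ^+ 2.
  by rewrite /a rmorphM /= -innerC fmorphV /= (CrealP _)// realX// normr_real.
have := inner_ge0 (x - a *: y).
rewrite innerBl !innerBr !(innerZl, innerZr) -!sqr_norm_inner aE normCK -innerC.
have -> : `|x| ^+ 2 - '[y, x] / `|y| ^+ 2 * '[x, y] -
   (a * '[y, x] - a * ('[y, x] / `|y| ^+ 2 * `|y| ^+ 2)) =
   (`|x| ^+ 2 * `|y| ^+ 2 - '[x, y] * '[y, x]) / `|y| ^+ 2.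
  by rewrite /a; field; rewrite normr_eq0.
by rewrite pmulr_lge0 ?invr_gt0// subr_ge0.
Qed.

End InnerTheory.

Section Riesz.
Variables (R : realType) (H : hilbertType R) (f : H -> R[i]).
Hypothesis fD : {morph f : x y / x + y}.
Hypothesis fZ : forall c x, f (c *: x) = c * f x.
Variable M : R[i].
Hypothesis fM : forall x, `|f x| <= M * `|x|.

Let B (x y : H) : R := complex.Re '[x, y].
Let g (x : H) : R := complex.Re (f x).
Let J x := B x x - 2 * g x.

Let ReD (a b : R[i]) : complex.Re (a + b) = complex.Re a + complex.Re b.
Proof. by case: a; case: b. Qed.
Let ReN (a : R[i]) : complex.Re (- a) = - complex.Re a.
Proof. by case: a. Qed.
Let ReZ (a : R) (b : R[i]) : complex.Re (a%:C * b) = a * complex.Re b.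
Proof. by case: b => ? ?; rewrite /= mul0r subr0. Qed.
Let BDl x y z : B (x + y) z = B x z + B y z.
Proof. by rewrite /B innerDl ReD. Qed.
Let BC x y : B x y = B y x.
Proof. by rewrite /B innerC; case: '[y, x]. Qed.
Let BDr x y z : B z (x + y) = B z x + B z y.
Proof. by rewrite BC BDl !(BC z). Qed.
Let BZl a x y : B (a%:C *: x) y = a * B x y.
Proof. by rewrite /B innerZl ReZ. Qed.
Let BZr a x y : B x (a%:C *: y) = a * B x y.
Proof. by rewrite BC BZl BC. Qed.
Let gD x y : g (x + y) = g x + g y.
Proof. by rewrite /g fD ReD. Qed.
Let gZ a x : g (a%:C *: x) = a * g x.
Proof. by rewrite /g fZ ReZ. Qed.

Let ge0cE (z : R[i]) : 0 <= z -> z = (complex.Re z)%:C.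
Proof. by case: z => a b; rewrite lecE /= => /andP[/eqP -> _]. Qed.
Let N (x : H) : R := complex.Re (`|x| : R[i]).
Let normCE x : `|x| = (N x)%:C.
Proof. exact/ge0cE/normr_ge0. Qed.
Let BE x : B x x = N x ^+ 2.
Proof. by rewrite /B -sqr_norm_inner normCE -rmorphXn. Qed.
Let N_ge0 x : 0 <= N x.
Proof. by have := normr_ge0 x; rewrite normCE lecR. Qed.
Let Re_le_norm (z : R[i]) : (`|complex.Re z| : R)%:C <= `|z|.
Proof. exact: normc_ge_Re. Qed.

Let m : R := complex.Re (`|M| : R[i]).
Let mE : `|M| = m%:C.
Proof. exact/ge0cE/normr_ge0. Qed.
Let g_le x : `|g x| <= m * N x.
Proof.
rewrite -lecR rmorphM /= -mE -normCE (le_trans (Re_le_norm _))//.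
rewrite (le_trans (fM x))//; have := le_trans (normr_ge0 _) (fM x).
by move=> /ger0_norm; rewrite normrM normr_id => ->.
Qed.

Let J_lb x : - m ^+ 2 <= J x.
Proof.
have := g_le x; rewrite ler_norml => /andP[_]; rewrite /J BE.
move: (N x) (g x) => t a h.
have : 0 <= (t - m) ^+ 2 by exact: sqr_ge0.
by nra.
Qed.

Let d := inf (range J).
Let J_inf x : d <= J x.
Proof.
by apply: ge_inf; [exists (- m ^+ 2) => _ [y _ <-] | exists x].
Qed.
Let J_ex (e : R) : 0 < e -> exists x, J x < d + e.
Proof.
move=> e0; have [|_ [x _ <-] ?] := @inf_adherent _ (range J) e e0.
  split; first by exists (J 0), 0.
  by exists (- m ^+ 2) => _ [y _ <-].
by exists x.
Qed.

Let BN x y : B x (- y) = - B x y.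
Proof. by rewrite /B innerNr ReN. Qed.
Let gN x : g (- x) = - g x.
Proof. by rewrite -scaleN1r /g fZ mulN1r ReN. Qed.

Let J_parallelogram (e : R) x y : J x < d + e -> J y < d + e ->
  B (x - y) (x - y) < 4 * e.
Proof.
move=> Jx Jy; have := J_inf ((2^-1)%:C *: (x + y)); rewrite /J in Jx Jy *.
have BNl a b : B (- a) b = - B a b by rewrite BC BN BC.
rewrite BZl BZr gZ gD !(BDl, BDr, BN, BNl) (BC y x).
by move: Jx Jy; lra.
Qed.

Let F := filter_from [set e : R | 0 < e] (fun e => [set x | J x < d + e]).
Let FF : ProperFilter F.
Proof.
apply: filter_from_proper; last by move=> e /J_ex [x]; exists x.
apply: filter_from_filter; first by exists 1 => /=.
move=> e1 e2 /= e10 e20; exists (Num.min e1 e2) => /=.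
  by rewrite lt_min e10.
move=> x /= Jx; split; apply: lt_le_trans Jx _; rewrite lerD2l ge_min lexx//.
by rewrite orbT.
Qed.
#[local] Existing Instance FF.

Let FC : cvg F.
Proof.
apply: (@cauchy_cvg H F FF); apply: (@cauchy_exP _ H F _) => e; rewrite ltcE /= => /andP[/eqP ei e0].
have -> : e = (complex.Re e)%:C by case: e ei {e0} => ? ? /= ->.
move: (complex.Re e) e0 => {ei}e e0.
have e4 : 0 < e ^+ 2 / 4 by rewrite divr_gt0 ?exprn_gt0.
have [x Jx] := J_ex e4; exists x; exists (e ^+ 2 / 4) => // y /= Jy.
rewrite -ball_normE /= normCE ltcR.
have := J_parallelogram Jx Jy; rewrite BE.
have -> : 4 * (e ^+ 2 / 4) = e ^+ 2 by field.
by rewrite ltr_pXn2r// nnegrE ?N_ge0// ltW.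
Qed.

Let u := lim F.

Let B_le x y : `|B x y| <= N x * N y.
Proof.
rewrite -lecR rmorphM /= -!normCE (le_trans (Re_le_norm _))//.
exact: CauchySchwarz_inner.
Qed.

Let J_u h : 0 <= 2 * (B h u - g h) + B h h.
Proof.
apply/ler_addgt0Pl => e e0.
have e2 : 0 < e / 2 by rewrite divr_gt0.
have Nh : 0 < 4 * (N h + 1) by rewrite mulr_gt0// ltr_wpDl// N_ge0.
have e4 : 0 < e / (4 * (N h + 1)) by rewrite divr_gt0.
have Fu : F (ball u (e / (4 * (N h + 1)))%:C).
  by apply: FC; apply: nbhsx_ballx; rewrite ltcR.
have FJ : F [set x | J x < d + e / 2] by exists (e / 2).
have [x [/= Jx]] := filter_ex (filterI FJ Fu).
rewrite -ball_normE /= normCE ltcR ltr_pdivlMr// => ux.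
have := J_inf (x + h); have := B_le h (u - x); rewrite ler_norml => /andP[+ _].
rewrite BDr BN lerBrDr => h1.
have h2 : 4 * (N h * N (u - x)) <= e.
  by apply: le_trans (ltW ux); have := N_ge0 (u - x); nra.
move: Jx; rewrite /J gD !(BDl, BDr) (BC x h).
by move: (N h * N (u - x)) h1 h2 => w; lra.
Qed.

Let g_le_B h : g h <= B h u.
Proof.
rewrite leNgt; apply/negP => hlt; set b := B h h.
have b0 : 0 <= b by rewrite /b BE sqr_ge0.
have b1 : 0 < b + 1 by rewrite ltr_wpDl.
pose t := (g h - B h u) / (b + 1).
have t0 : 0 < t by rewrite divr_gt0// subr_gt0.
have := J_u (t%:C *: h); rewrite !(BZl, BZr) gZ -/b.
have -> : 2 * (t * B h u - t * g h) + t * (t * b) =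
  t * (t * b - 2 * (g h - B h u)) by ring.
rewrite pmulr_rge0// /t mulrAC subr_ge0 ler_pdivlMr//.
by move: hlt; nra.
Qed.

Let B_u h : B h u = g h.
Proof.
have BNl a b : B (- a) b = - B a b by rewrite BC BN BC.
by apply/eqP; rewrite eq_le g_le_B -lerN2 -BNl -gN g_le_B.
Qed.

Lemma Riesz_representation : exists u, forall x, f x = '[x, u].
Proof.
exists u => x; apply/eqP; rewrite eq_complex; apply/andP; split; apply/eqP.
  by rewrite -[LHS]/(g x) -B_u.
have := B_u ((0 +i* 1) *: x); rewrite /B /g innerZl fZ.
case: (f x) (inner x u) => [a b] [a' b'] /=.
by rewrite !mul0r !mul1r !sub0r => /oppr_inj ->.
Qed.

End Riesz.

Section BoundedOperators.
Variables (R : realType) (H : hilbertType R).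

Record bounded_operator := BoundedOperator {
  bop_fun :> H -> H ;
  bop_linear : linear bop_fun ;
  bop_bounded : exists M : R[i], forall x, `|bop_fun x| <= M * `|x| }.
Implicit Types A Q S T U : bounded_operator.

HB.instance Definition _ T :=
  GRing.isLinear.Build R[i] H H *:%R (bop_fun T) (@bop_linear T).

HB.instance Definition _ := gen_eqMixin bounded_operator.
HB.instance Definition _ := gen_choiceMixin bounded_operator.

Lemma bop_ext S T : (forall x, S x = T x) -> S = T.
Proof.
case: S T => [f lf bf] [g lg bg] /= /funext fg; rewrite fg in lf bf *.
by congr BoundedOperator; exact: Prop_irrelevance.
Qed.

Fact bop0_linear : linear (fun _ : H => 0 : H).
Proof. by move=> c x y; rewrite scaler0 addr0. Qed.
Fact bop0_bounded : exists M : R[i], forall x : H, `|0 : H| <= M * `|x|.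
Proof. by exists 0 => x; rewrite normr0 mul0r. Qed.
Definition bop0 := BoundedOperator bop0_linear bop0_bounded.

Fact bop1_linear : linear (@id H). Proof. by []. Qed.
Fact bop1_bounded : exists M : R[i], forall x : H, `|x| <= M * `|x|.
Proof. by exists 1 => x; rewrite mul1r. Qed.
Definition bop1 := BoundedOperator bop1_linear bop1_bounded.

Fact bopN_linear T : linear (fun x => - T x).
Proof. by move=> c x y; rewrite linearP opprD scalerN. Qed.
Fact bopN_bounded T : exists M : R[i], forall x, `|- T x| <= M * `|x|.
Proof. by have [M TM] := bop_bounded T; exists M => x; rewrite normrN. Qed.
Definition bopN T := BoundedOperator (bopN_linear T) (bopN_bounded T).

Fact bopD_linear S T : linear (fun x => S x + T x).
Proof. by move=> c x y; rewrite !linearP scalerDr addrACA. Qed.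
Fact bopD_bounded S T : exists M : R[i], forall x, `|S x + T x| <= M * `|x|.
Proof.
have [M SM] := bop_bounded S; have [N TN] := bop_bounded T.
by exists (M + N) => x; rewrite (le_trans (ler_normD _ _))// mulrDl lerD.
Qed.
Definition bopD S T := BoundedOperator (bopD_linear S T) (bopD_bounded S T).

Lemma bop_bounded_ge0 T :
  exists2 M : R[i], 0 <= M & forall x, `|T x| <= M * `|x|.
Proof.
have [M TM] := bop_bounded T; exists `|M| => // x.
have /ger0_norm := le_trans (normr_ge0 _) (TM x).
by rewrite normrM normr_id => ->.
Qed.

Fact bopM_linear S T : linear (fun x => S (T x)).
Proof. by move=> c x y; rewrite !linearP. Qed.
Fact bopM_bounded S T : exists M : R[i], forall x, `|S (T x)| <= M * `|x|.
Proof.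
have [M M0 SM] := bop_bounded_ge0 S; have [N _ TN] := bop_bounded_ge0 T.
by exists (M * N) => x; rewrite (le_trans (SM _))// -mulrA ler_wpM2l.
Qed.
Definition bopM S T := BoundedOperator (bopM_linear S T) (bopM_bounded S T).

Fact bopDA : associative bopD.
Proof. by move=> S T U; apply: bop_ext => x /=; rewrite addrA. Qed.
Fact bopDC : commutative bopD.
Proof. by move=> S T; apply: bop_ext => x /=; rewrite addrC. Qed.
Fact bop0D : left_id bop0 bopD.
Proof. by move=> T; apply: bop_ext => x /=; rewrite add0r. Qed.
Fact bopND : left_inverse bop0 bopN bopD.
Proof. by move=> T; apply: bop_ext => x /=; rewrite addNr. Qed.

HB.instance Definition _ :=
  GRing.isZmodule.Build bounded_operator bopDA bopDC bop0D bopND.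

Fact bopMA : associative bopM.
Proof. by move=> S T U; apply: bop_ext. Qed.
Fact bop1M : left_id bop1 bopM.
Proof. by move=> T; apply: bop_ext. Qed.
Fact bopM1 : right_id bop1 bopM.
Proof. by move=> T; apply: bop_ext. Qed.
Fact bopMDl : left_distributive bopM bopD.
Proof. by move=> S T U; apply: bop_ext. Qed.
Fact bopMDr : right_distributive bopM bopD.
Proof. by move=> S T U; apply: bop_ext => x /=; rewrite linearD. Qed.

(* A possibly zero ring, since H may be the zero space. *)
HB.instance Definition _ :=
  GRing.Zmodule_isPzRing.Build bounded_operator bopMA bop1M bopM1 bopMDl bopMDr.

Lemma bop_addE S T x : (S + T) x = S x + T x. Proof. by []. Qed.
Lemma bop_oppE T x : (- T) x = - T x. Proof. by []. Qed.
Lemma bop_zeroE x : (0 : bounded_operator) x = 0. Proof. by []. Qed.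
Lemma bop_mulE S T x : (S * T) x = S (T x). Proof. by []. Qed.
Lemma bop_oneE x : (1 : bounded_operator) x = x. Proof. by []. Qed.

Lemma adjoint_exists T :
  exists S : bounded_operator, forall x y, '[T x, y] = '[x, S y].
Proof.
have [M M0 TM] := bop_bounded_ge0 T.
have /choice[S TS] : forall y, exists u, forall x, '[T x, y] = '[x, u].
  move=> y; apply: (@Riesz_representation _ _ (fun x => '[T x, y]) _ _
    (M * `|y|)).
  - by move=> a b; rewrite linearD innerDl.
  - by move=> c x; rewrite linearZ innerZl.
  - move=> x; rewrite (le_trans (CauchySchwarz_inner _ _))//.
    by rewrite mulrAC ler_wpM2r.
have S_linear : linear S.
  move=> c x y; apply: inner_injr => z.
  by rewrite -TS !innerDr !innerZr -!TS.
have S_bounded : exists N : R[i], forall x, `|S x| <= N * `|x|.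
  exists M => y; have [->|Sy0] := eqVneq (S y) 0.
    by rewrite normr0 mulr_ge0.
  have Sy_gt0 : 0 < `|S y| by rewrite normr_gt0.
  rewrite -(ler_pM2l Sy_gt0) -expr2 mulrCA mulrA sqr_norm_inner -TS.
  have /ger0_norm <- : 0 <= '[T (S y), y] by rewrite TS inner_ge0.
  by rewrite (le_trans (CauchySchwarz_inner _ _))// ler_wpM2r.
by exists (BoundedOperator S_linear S_bounded).
Qed.

Definition adjoint T : bounded_operator := projT1 (cid (adjoint_exists T)).

Lemma adjointP T x y : '[T x, y] = '[x, adjoint T y].
Proof. by rewrite /adjoint; case: cid. Qed.

Definition positive_operator A : Prop := forall x, 0 <= '[A x, x].

Definition doubly_commuting T Q : Prop :=
  T * Q = Q * T /\ T * adjoint Q = adjoint Q * T.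

Definition nilpotent_of_order (r : nat) Q : Prop :=
  Q ^+ r = 0 /\ Q ^+ r.-1 <> 0.

Definition S_op A (n : nat) T : bounded_operator :=
  \sum_(k < n.+1)
    (-1) ^+ (n - k) * 'C(n, k)%:R * (adjoint T ^+ k * A * T ^+ (n - k)).

Definition zeta_op A (n : nat) T : bounded_operator :=
  \sum_(k < n.+1) 'C(n, k)%:R * (adjoint T ^+ k * A * T ^+ (n - k)).

Definition Omega_op A (m n : nat) T : bounded_operator :=
  \sum_(j < m.+1)
    (-1) ^+ (m - j) * 'C(m, j)%:R * (adjoint T ^+ j * S_op A n T * T ^+ j).

Definition Lambda_op A (m n : nat) T : bounded_operator :=
  \sum_(j < m.+1)
    (-1) ^+ (m - j) * 'C(m, j)%:R * (adjoint T ^+ j * zeta_op A n T * T ^+ j).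

Definition isosymmetric A (m n : nat) T : Prop := Omega_op A m n T = 0.

Definition skew_isosymmetric A (m n : nat) T : Prop := Lambda_op A m n T = 0.

End BoundedOperators.

Notation "''B' ( H )" := (bounded_operator H)
  (format "''B' ( H )") : type_scope.

(* Main.v *)
Require Import Defs.
From HB Require Import structures.
From mathcomp Require Import all_boot all_order all_algebra.
From mathcomp Require Import complex.
From mathcomp Require Import zify.
From mathcomp Require Import boolp classical_sets functions cardinality reals.
From mathcomp Require Import topology normedtype.

(** Let [x] and [y] be the operators [X |-> T^* X] and [X |-> X T] on B(H).
    They commute, so by the binomial theorem the sums of the statement are
    values of polynomials in [x] and [y]:
<<
      Omega_A^(m,n)(T)  = (x y - 1)^m (x - y)^n A,
      Lambda_A^(m,n)(T) = (x y - 1)^m (x + y)^n A.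
>>
    Replacing [T] by [T + Q] replaces [x] by [x + a] and [y] by [y + b], where
    [a] is [X |-> Q^* X] and [b] is [X |-> X Q]. All four operators commute and
    [a^r = b^r = 0]. Both [p = x y - 1] and [q = x + y] or [x - y] change by an
    element of the ideal [(a, b)], and every monomial [a^s b^t] with
    [s + t >= 2 r - 1] vanishes. Hence in the expansion of [p'^M q'^N], where
    [p'] and [q'] are the perturbed elements, at most [2 r - 2] factors are
    perturbations; so [p^m q^n] divides [p'^M q'^N] as soon as
    [M >= m + 2 r - 2] and [N >= n + 2 r - 2] ([perturbed_multiple]). Applying
    this to [A] gives both claims ([iso_form_perturbed]).

    The expansion is organised by a filtration ([level]) that counts, next to
    the factors [p] and [q], the factors [a] and [b] that stand in for them. *)

Set Implicit Arguments.
Unset Strict Implicit.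
Unset Printing Implicit Defensive.

Import GRing.Theory.
Local Open Scope ring_scope.

(** * Perturbing commuting elements by nilpotents *)

Section Filtration.
Variables (E : pzRingType) (p q a b g : E).
Hypotheses (apC : GRing.comm a p) (aqC : GRing.comm a q).
Hypotheses (bpC : GRing.comm b p) (bqC : GRing.comm b q).
Hypotheses (abC : GRing.comm a b) (pqC : GRing.comm p q).

Definition left_multiple (z : E) := exists c, z = c * g.

Lemma left_multipleD z1 z2 :
  left_multiple z1 -> left_multiple z2 -> left_multiple (z1 + z2).
Proof. by move=> [c1 ->] [c2 ->]; exists (c1 + c2); rewrite mulrDl. Qed.

Lemma left_multipleMl c z : left_multiple z -> left_multiple (c * z).
Proof. by move=> [d ->]; exists (c * d); rewrite mulrA. Qed.

Definition monom s t k l := a ^+ s * b ^+ t * p ^+ k * q ^+ l.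

Lemma monom_mulq s t k l : monom s t k l * q = monom s t k l.+1.
Proof. by rewrite /monom exprSr !mulrA. Qed.

Lemma monom_mulp s t k l : monom s t k l * p = monom s t k.+1 l.
Proof. by rewrite /monom -mulrA -(commrX l pqC) exprSr !mulrA. Qed.

Lemma monom_mulb s t k l : monom s t k l * b = monom s t.+1 k l.
Proof.
rewrite /monom -mulrA -(commrX l bqC) !mulrA -(mulrA _ _ b) -(commrX k bpC).
by rewrite exprSr !mulrA.
Qed.

Lemma monom_mula s t k l : monom s t k l * a = monom s.+1 t k l.
Proof.
rewrite /monom -mulrA -(commrX l aqC) !mulrA -(mulrA _ _ a) -(commrX k apC).
by rewrite !mulrA -(mulrA _ _ a) -(commrX t abC) exprSr !mulrA.
Qed.

Definition comm_pqab c :=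
  [/\ GRing.comm c a, GRing.comm c b, GRing.comm c p & GRing.comm c q].

Lemma monom_commutes c s t k l : comm_pqab c ->
  GRing.comm c (monom s t k l).
Proof.
by case=> ca cb cp cq; do 3![apply: commrM; last exact: commrX]; exact: commrX.
Qed.

Lemma monom_mulCA c u z s t k l : comm_pqab c ->
  monom s t k l * (c * u * z) = c * (monom s t k l * u * z).
Proof.
move=> /(@monom_commutes c s t k l); move: (monom s t k l) => w cw.
by rewrite !mulrA -cw.
Qed.

(** An element of [level i j] becomes a left multiple of [g] once it is
    multiplied by [i] factors [p] and [j] factors [q], where a factor [a] or [b]
    may stand in for one [p] and one [q] at the same time. This exchange is what
    makes a perturbed [p] or [q] cost no more than the original one: its
    summands [c a] and [d b] lower both indices. *)
Definition level i j z := forall s t k l,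
  (i <= k + (s + t))%N -> (j <= l + (s + t))%N ->
  left_multiple (monom s t k l * z).

Lemma level_perturbed_l c d i j z : comm_pqab c -> comm_pqab d ->
  level i.+1 j z -> level i j ((p + c * a + d * b) * z).
Proof.
move=> cC dC zij s t k l ik jl; rewrite !mulrDl !mulrDr.
apply: left_multipleD; first apply: left_multipleD.
- by rewrite mulrA monom_mulp; apply: zij; lia.
- rewrite monom_mulCA// monom_mula.
  by apply/left_multipleMl/zij; lia.
- rewrite monom_mulCA// monom_mulb.
  by apply/left_multipleMl/zij; lia.
Qed.

Lemma level_perturbed_r c d i j z : comm_pqab c -> comm_pqab d ->
  level i j.+1 z -> level i j ((q + c * a + d * b) * z).
Proof.
move=> cC dC zij s t k l ik jl; rewrite !mulrDl !mulrDr.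
apply: left_multipleD; first apply: left_multipleD.
- by rewrite mulrA monom_mulq; apply: zij; lia.
- rewrite monom_mulCA// monom_mula.
  by apply/left_multipleMl/zij; lia.
- rewrite monom_mulCA// monom_mulb.
  by apply/left_multipleMl/zij; lia.
Qed.

End Filtration.

(** The element [1] lies in [level M N]: a monomial with [s >= r] or [t >= r]
    vanishes, and otherwise [s + t <= 2 r - 2] leaves at least [m] factors [p]
    and [n] factors [q]. Each perturbed factor then lowers one index by one, and
    [level 0 0] consists of left multiples. *)
Lemma perturbed_multiple (E : pzRingType) (p q a b c d e f : E)
    (r m n M N : nat) :
  GRing.comm a p -> GRing.comm a q -> GRing.comm b p -> GRing.comm b q ->
  GRing.comm a b -> GRing.comm p q ->
  comm_pqab p q a b c -> comm_pqab p q a b d ->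
  comm_pqab p q a b e -> comm_pqab p q a b f ->
  a ^+ r = 0 -> b ^+ r = 0 ->
  (m + 2 * r.-1 <= M)%N -> (n + 2 * r.-1 <= N)%N ->
  left_multiple (p ^+ m * q ^+ n)
    ((p + c * a + d * b) ^+ M * (q + e * a + f * b) ^+ N).
Proof.
move=> apC aqC bpC bqC abC pqC cC dC eC fC ar br leM leN.
have level1 : level p q a b (p ^+ m * q ^+ n) M N 1.
  move=> s t k l leMk leNl; rewrite mulr1 /monom.
  have [les|gts] := leqP r s.
    by exists 0; rewrite -(subnK les) exprD ar mulr0 !mul0r.
  have [ler_t|gtt] := leqP r t.
    by exists 0; rewrite -(subnK ler_t) exprD br !(mulr0, mul0r).
  exists (a ^+ s * b ^+ t * p ^+ (k - m) * q ^+ (l - n)).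
  have /subnK {1}<- : (m <= k)%N by lia.
  have /subnK {1}<- : (n <= l)%N by lia.
  rewrite !exprD !mulrA; congr (_ * _); rewrite -!mulrA; do 3 congr (_ * _).
  exact: commrX (commr_sym (commrX _ (commr_sym pqC))).
have levelq k : (k <= N)%N ->
    level p q a b (p ^+ m * q ^+ n) M (N - k) ((q + e * a + f * b) ^+ k).
  elim: k => [|k IHk] ltkN; first by rewrite subn0 expr0.
  rewrite exprS; apply: level_perturbed_r => //.
  by rewrite subnSK//; apply: IHk; apply: ltnW.
have levelp k : (k <= M)%N -> level p q a b (p ^+ m * q ^+ n) (M - k) 0
    ((p + c * a + d * b) ^+ k * (q + e * a + f * b) ^+ N).
  elim: k => [|k IHk] ltkM.
    by rewrite subn0 expr0 mul1r -(subnn N); apply: levelq.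
  rewrite exprS -mulrA; apply: level_perturbed_l => //.
  by rewrite subnSK//; apply: IHk; apply: ltnW.
have := levelp M (leqnn M) 0 0 0 0; rewrite subnn /monom !expr0 !mul1r.
exact.
Qed.

(** * The ring of additive endomorphisms *)

Section Endomorphisms.
Variable V : zmodType.

(** The ring in which left and right multiplications by operators can be added
    and composed, hence in which the binomial theorem applies to them. *)
Record endo := Endo {
  endo_fun :> V -> V;
  endo_morph : {morph endo_fun : u v / u + v} }.
Implicit Types f g h : endo.

Lemma endo_ext f g : f =1 g -> f = g.
Proof.
case: f g => [f fD] [g gD] /= /funext fg; rewrite fg in fD *.
by congr Endo; exact: Prop_irrelevance.
Qed.

Lemma endo_apply0 f : f 0 = 0.
Proof. by apply: (addrI (f 0)); rewrite -endo_morph !addr0. Qed.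

Fact endo0_morph : {morph (fun _ : V => 0 : V) : u v / u + v}.
Proof. by move=> u v; rewrite addr0. Qed.
Fact endo1_morph : {morph (@id V) : u v / u + v}.
Proof. by []. Qed.
Fact endoN_morph f : {morph (fun u => - f u) : u v / u + v}.
Proof. by move=> u v; rewrite endo_morph opprD. Qed.
Fact endoD_morph f g : {morph (fun u => f u + g u) : u v / u + v}.
Proof. by move=> u v; rewrite !endo_morph addrACA. Qed.
Fact endoM_morph f g : {morph (fun u => f (g u)) : u v / u + v}.
Proof. by move=> u v; rewrite !endo_morph. Qed.

Definition endo0 := Endo endo0_morph.
Definition endo1 := Endo endo1_morph.
Definition endoN f := Endo (endoN_morph f).
Definition endoD f g := Endo (endoD_morph f g).
Definition endoM f g := Endo (endoM_morph f g).

Fact endoDA : associative endoD.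
Proof. by move=> f g h; apply: endo_ext => u /=; rewrite addrA. Qed.
Fact endoDC : commutative endoD.
Proof. by move=> f g; apply: endo_ext => u /=; rewrite addrC. Qed.
Fact endo0D : left_id endo0 endoD.
Proof. by move=> f; apply: endo_ext => u /=; rewrite add0r. Qed.
Fact endoND : left_inverse endo0 endoN endoD.
Proof. by move=> f; apply: endo_ext => u /=; rewrite addNr. Qed.
Fact endoMA : associative endoM.
Proof. by move=> f g h; apply: endo_ext. Qed.
Fact endo1M : left_id endo1 endoM.
Proof. by move=> f; apply: endo_ext. Qed.
Fact endoM1 : right_id endo1 endoM.
Proof. by move=> f; apply: endo_ext. Qed.
Fact endoMDl : left_distributive endoM endoD.
Proof. by move=> f g h; apply: endo_ext. Qed.
Fact endoMDr : right_distributive endoM endoD.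
Proof. by move=> f g h; apply: endo_ext => u /=; rewrite endo_morph. Qed.

HB.instance Definition _ := gen_eqMixin endo.
HB.instance Definition _ := gen_choiceMixin endo.
HB.instance Definition _ :=
  GRing.isZmodule.Build endo endoDA endoDC endo0D endoND.
HB.instance Definition _ :=
  GRing.Zmodule_isPzRing.Build endo endoMA endo1M endoM1 endoMDl endoMDr.

Lemma endo_sumE (I : Type) (s : seq I) (P : pred I) (F : I -> endo) v :
  (\sum_(i <- s | P i) F i) v = \sum_(i <- s | P i) F i v.
Proof. by apply: (big_morph (fun f : endo => f v)). Qed.

Lemma endo_mulrnE f n v : (f *+ n) v = f v *+ n.
Proof. by elim: n => [//|n IHn]; rewrite !mulrS -IHn. Qed.

End Endomorphisms.

(** * Two-sided binomial sums as polynomials in multiplication operators *)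

Section Multiplications.
Variable B : pzRingType.
Implicit Types X Y A P Q : B.

Definition lmul X : endo B := Endo (mulrDr X).
Definition rmul Y : endo B := Endo (fun A P => mulrDl A P Y).

Lemma endo_signE (k : nat) (f : endo B) A :
  ((-1) ^+ k * f) A = (-1) ^+ k * f A.
Proof. by rewrite -signr_odd -[in RHS]signr_odd !mulr_sign; case: odd. Qed.

Lemma lmulX X k A : (lmul X ^+ k) A = X ^+ k * A.
Proof.
elim: k => [|k IHk]; first by rewrite !expr0 mul1r.
by rewrite !exprS -mulrA -IHk.
Qed.

Lemma rmulX Y k A : (rmul Y ^+ k) A = A * Y ^+ k.
Proof.
elim: k => [|k IHk]; first by rewrite !expr0 mulr1.
by rewrite exprS exprSr mulrA -IHk.
Qed.

Lemma lmulD X P : lmul (X + P) = lmul X + lmul P.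
Proof. by apply: endo_ext => A; apply: mulrDl. Qed.

Lemma rmulD Y Q : rmul (Y + Q) = rmul Y + rmul Q.
Proof. by apply: endo_ext => A; apply: mulrDr. Qed.

Lemma lmul_rmulC X Y : GRing.comm (lmul X) (rmul Y).
Proof. by apply: endo_ext => A; apply: mulrA. Qed.

Lemma lmul_lmulC X P : GRing.comm X P -> GRing.comm (lmul X) (lmul P).
Proof. by move=> XP; apply: endo_ext => A /=; rewrite !mulrA XP. Qed.

Lemma rmul_rmulC Y Q : GRing.comm Y Q -> GRing.comm (rmul Y) (rmul Q).
Proof. by move=> YQ; apply: endo_ext => A /=; rewrite -!mulrA YQ. Qed.

(** The sign is a parameter so that odd [e] gives the sums of isosymmetry and
    even [e], after [expr1n], those of skew isosymmetry. *)
Lemma binomial_signE (e : nat) n X Y A :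
  ((lmul X + (-1) ^+ e * rmul Y) ^+ n) A =
  \sum_(k < n.+1) ((-1) ^+ e) ^+ (n - k) * 'C(n, k)%:R *
    (X ^+ k * A * Y ^+ (n - k)).
Proof.
have C : GRing.comm ((-1) ^+ e * rmul Y) (lmul X).
  apply: commr_sym; apply: commrM; first exact: commr_sign.
  exact: lmul_rmulC.
(* With the summand of [X] last, the summation index is the exponent of [X]. *)
rewrite addrC exprDn_comm// endo_sumE; apply: eq_bigr => k _.
rewrite endo_mulrnE exprMn_comm; last exact/commr_sym/commr_sign.
rewrite -!exprM. rewrite -[X in endo_fun X]mulrA endo_signE -mulrA mulr_natl mulrnAr.
by congr (_ * _ *+ _); rewrite /= lmulX rmulX.
Qed.

Lemma binomial_prodE m X Y A :
  ((lmul X * rmul Y - 1) ^+ m) A =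
  \sum_(j < m.+1) (-1) ^+ (m - j) * 'C(m, j)%:R * (X ^+ j * A * Y ^+ j).
Proof.
rewrite addrC exprDn_comm; last exact/commr_sym/commrN1.
rewrite endo_sumE; apply: eq_bigr => j _.
rewrite endo_mulrnE endo_signE exprMn_comm; last exact: lmul_rmulC.
rewrite -mulrA mulr_natl mulrnAr.
by congr (_ * _ *+ _); rewrite /= lmulX rmulX mulrA.
Qed.

(* Decomposes one side of the commutation, then the other, down to pairs of
   elements whose commutation is among the hypotheses. *)
Ltac commutes_r := repeat first
  [ exact: commr1 | exact: commr_sign | assumption | by apply: commr_sym
  | apply: commrB | apply: commrD | apply: commrM ].
Ltac commutes := commutes_r; apply: commr_sym; commutes_r.

(** Odd [s] gives isosymmetry and even [s] skew isosymmetry. With [x], [y], [a],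
    [b] the multiplications by [X], [Y], [P], [Q], the two perturbations are
    [(x + a) (y + b) - 1 = (x y - 1) + y a + (x + a) b] and
    [(x + a) +- (y + b) = (x +- y) + a +- b], as [perturbed_multiple] needs. *)
Lemma iso_form_perturbed (s r m n M N : nat) X Y P Q A :
  GRing.comm X P -> GRing.comm Y Q -> P ^+ r = 0 -> Q ^+ r = 0 ->
  (m + 2 * r.-1 <= M)%N -> (n + 2 * r.-1 <= N)%N ->
  ((lmul X * rmul Y - 1) ^+ m * (lmul X + (-1) ^+ s * rmul Y) ^+ n) A = 0 ->
  ((lmul (X + P) * rmul (Y + Q) - 1) ^+ M *
   (lmul (X + P) + (-1) ^+ s * rmul (Y + Q)) ^+ N) A = 0.
Proof.
move=> XP YQ Pr Qr leM leN A0; rewrite lmulD rmulD.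
have xaC := lmul_lmulC XP; have ybC := rmul_rmulC YQ.
have xyC := lmul_rmulC X Y; have xbC := lmul_rmulC X Q.
have ayC := lmul_rmulC P Y; have abC := lmul_rmulC P Q.
have ar : lmul P ^+ r = 0.
  by apply: endo_ext => Z; rewrite lmulX Pr mul0r.
have br : rmul Q ^+ r = 0.
  by apply: endo_ext => Z; rewrite rmulX Qr mulr0.
move: (lmul X) (rmul Y) (lmul P) (rmul Q) => x y a b
  in A0 xaC ybC xyC xbC ayC abC ar br *.
have xx : GRing.comm x x by []. have yy : GRing.comm y y by [].
pose p := x * y - 1; pose q := x + (-1) ^+ s * y.
have -> : (x + a) * (y + b) - 1 = p + y * a + (x + a) * b.
  by rewrite /p mulrDr (mulrDl x) ayC addrAC; congr (_ + _); apply: addrAC.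
have -> : x + a + (-1) ^+ s * (y + b) = q + 1 * a + (-1) ^+ s * b.
  by rewrite /q mul1r mulrDr !addrA (addrAC _ a).
have [||||||||||c ->] := @perturbed_multiple _ p q a b y (x + a) 1
  ((-1) ^+ s) r m n M N _ _ _ _ _ _ _ _ _ _ ar br leM leN.
1-6: by commutes.
1-4: by split; commutes.
exact: etrans (congr1 c A0) (endo_apply0 c).
Qed.

End Multiplications.

(** * Isosymmetric operators *)

Section Operators.
Variables (R : realType) (H : hilbertType R).
Implicit Types A T Q : 'B(H).

Lemma adjointD T Q : adjoint (T + Q) = adjoint T + adjoint Q.
Proof.
apply: bop_ext => y; apply: inner_injr => x.
by rewrite -adjointP !bop_addE innerDl innerDr !adjointP.
Qed.

Lemma adjointM T Q : adjoint (T * Q) = adjoint Q * adjoint T.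
Proof.
apply: bop_ext => y; apply: inner_injr => x.
by rewrite -adjointP !bop_mulE !adjointP.
Qed.

Lemma adjoint1 : adjoint (1 : 'B(H)) = 1.
Proof. by apply: bop_ext => y; apply: inner_injr => x; rewrite -adjointP. Qed.

Lemma adjoint0 : adjoint (0 : 'B(H)) = 0.
Proof. by apply: (addrI (adjoint 0)); rewrite -adjointD !addr0. Qed.

Lemma adjointX T k : adjoint (T ^+ k) = adjoint T ^+ k.
Proof.
by elim: k => [|k IHk]; rewrite ?adjoint1// exprS exprSr adjointM IHk.
Qed.

Lemma Omega_opE A m n T : Omega_op A m n T =
  ((lmul (adjoint T) * rmul T - 1) ^+ m *
   (lmul (adjoint T) + (-1) ^+ 1 * rmul T) ^+ n) A.
Proof. by rewrite /= binomial_prodE binomial_signE. Qed.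

Lemma Lambda_opE A m n T : Lambda_op A m n T =
  ((lmul (adjoint T) * rmul T - 1) ^+ m *
   (lmul (adjoint T) + (-1) ^+ 0 * rmul T) ^+ n) A.
Proof.
rewrite /= binomial_prodE binomial_signE /Lambda_op /zeta_op.
by under [in RHS]eq_bigr do under eq_bigr do rewrite expr1n mul1r.
Qed.

End Operators.

Theorem theorem3p2 (R : realType) (H : hilbertType R) (A T Q : 'B(H))
    (r m n : nat) :
  separable_space H ->
  positive_operator A ->
  (1 <= r)%N ->
  nilpotent_of_order r Q ->
  doubly_commuting T Q ->
  (isosymmetric A m n T ->
     isosymmetric A (m + 2 * r - 2)%N (n + 2 * r - 1)%N (T + Q)) /\
  (skew_isosymmetric A m n T ->
     skew_isosymmetric A (m + 2 * r - 2)%N (n + 2 * r - 1)%N (T + Q)).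
Proof.
move=> _ _ r_gt0 [Qr _] [TQ _].
have TQ' : GRing.comm (adjoint T) (adjoint Q).
  by rewrite /GRing.comm -!adjointM TQ.
have Qr' : adjoint Q ^+ r = 0 by rewrite -adjointX Qr adjoint0.
have leM : (m + 2 * r.-1 <= m + 2 * r - 2)%N by lia.
have leN : (n + 2 * r.-1 <= n + 2 * r - 1)%N by lia.
rewrite /isosymmetric /skew_isosymmetric !Omega_opE !Lambda_opE !adjointD.
by split; apply: (@iso_form_perturbed _ _ r m n).
Qed.
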